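(* Let $G_p$ and $G_c$ be IF-OFP systems with passivity indices $(\nu_p,\rho_p)$ and $(\nu_c,\rho_c)$ respectively, interconnected in the plant-side event-triggered feedback loop described in the context, where the triggering instants $t_k$ are determined by the condition $\|e_p(t)\|_2^2>\delta\|y_p(t)\|_2^2$ with $\delta\in(0,1]$. Let $$\beta(\nu_c)=\begin{cases}\rho_p-\nu_c-\delta(1+\nu_c)&\text{if }\nu_c>0,\\ \rho_p-\delta&\text{if }\nu_c=0,\\ \rho_p+2\nu_c-\delta(1-3\nu_c)&\text{if }\nu_c<0.\end{cases}$$ Then the networked control system is passive from the inputs $w=\begin{bmatrix} w_1 \\ w_2 \end{bmatrix}$ to the outputs $y=\begin{bmatrix} y_p \\ y_c \end{bmatrix}$ with input passivity index $\epsilon_0$ and output passivity index $\delta_0$, that is, $$\dot V(t)\le w^T(t)y(t)-\epsilon_0\,w^T(t)w(t)-\delta_0\,y^T(t)y(t)$$ for a storage function $V$ of the interconnection, where $$\epsilon_0<\min(\nu_p,\ \nu_c-|\nu_c|),\qquad \delta_0<\min\Big(\beta(\nu_c)-\frac{\nu_c^2}{\nu_c-|\nu_c|-\epsilon_0},\ \rho_c+\nu_p-\frac14-\frac{\nu_p^2}{\nu_p-\epsilon_0}\Big).$$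
   Context: Systems: a system $G$ has the form $\dot x=f(x,u)$, $y=h(x,u)$ with state $x\in X\subset\mathbb{R}^n$ and $u(t),y(t)\in\mathbb{R}^m$. A storage function is a nonnegative function $V$ of the state; it is taken differentiable, and $\dot V(t)$ is the time derivative along solutions. $G$ is IF-OFP (input feed-forward output feedback passive) with input passivity index $\nu\in\mathbb{R}$ and output passivity index $\rho\in\mathbb{R}$ (of either sign) if there is a storage function $V$ with $\dot V\le u^Ty-\rho y^Ty-\nu u^Tu$ for all $t$ along all solutions. Plant-side event-triggered loop: $G_p$ (plant, state $x_p$, input $u_p$, output $y_p$) has indices $(\nu_p,\rho_p)$, and $G_c$ (controller, state $x_c$, input $u_c$, output $y_c$) has indices $(\nu_c,\rho_c)$; all inputs and outputs are $\mathbb{R}^m$-valued. External signals $w_1,w_2$ are $\mathbb{R}^m$-valued. At event instants $t_k$ the plant output is sampled and sent to the controller, and is held constant until the next event. For $t\in[t_k,t_{k+1})$: $u_p(t)=w_1(t)-y_c(t)$, $u_c(t)=w_2(t)+y_p(t_k)$, $e_p(t)=y_p(t)-y_p(t_k)$ (so $u_c=w_2+y_p-e_p$). A new event is triggered as soon as $\|e_p(t)\|_2^2>\delta\|y_p(t)\|_2^2$ (Euclidean norm of the vectors at time $t$), so that $e_p^T(t)e_p(t)\le\delta\, y_p^T(t)y_p(t)$ holds at all times. A storage function of the interconnection is a nonnegative function $V$ of $(x_p,x_c)$; inequalities on $\dot V$ are required along all solutions for all $t$ in the intervals $[t_k,t_{k+1})$. The indices $\epsilon_0,\delta_0$ may be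 of either sign. *)

(* Defs.v *)
From HB Require Import structures.
From mathcomp Require Import all_boot all_order all_algebra.
From mathcomp Require Import all_classical all_reals all_analysis.
Import Order.TTheory GRing.Theory Num.Theory.
Import numFieldNormedType.Exports.

Set Implicit Arguments.
Unset Strict Implicit.
Unset Printing Implicit Defensive.

Local Open Scope classical_set_scope.
Local Open Scope ring_scope.

Definition dot {R : realType} {m : nat} (u v : 'cV[R]_m) : R := (u^T *m v) 0 0.

(* The library norm on matrices is the sup norm; this is the squared Euclidean
   norm. *)
Definition normsq {R : realType} {m : nat} (u : 'cV[R]_m) : R := dot u u.

Definition time_interval {R : realType} (a b : \bar R) : set R :=
  [set s | (a <= s%:E)%E /\ (s%:E < b)%E].

(* Time derivatives are taken from the right.  The input of the controller
   jumps at the event instants, so that solutions are in general only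
   one-sidedly differentiable there; wherever the two-sided derivative exists
   it is equal to the right derivative. *)
Definition is_time_derivative {R : realType} {W : normedModType R}
    (x : R -> W) (t : R) (d : W) : Prop :=
  (s - t)^-1 *: (x s - x t) @[s --> t^'+] --> d.

Record system (R : realType) (n m : nat) := System {
  state_space : set 'cV[R]_n;
  dynamics : 'cV[R]_n -> 'cV[R]_m -> 'cV[R]_n;
  output : 'cV[R]_n -> 'cV[R]_m -> 'cV[R]_m }.

Definition solution {R : realType} {n m : nat} (G : system R n m) (I : set R)
    (x : R -> 'cV[R]_n) (u y : R -> 'cV[R]_m) : Prop :=
  {within I, continuous x} /\
  forall t, I t ->
    [/\ state_space G (x t),
        is_time_derivative x t (dynamics G (x t) (u t)) &
        y t = output G (x t) (u t)].

(* V is given on the ambient space; only its values and its differentiability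
   at the points of the state space X matter. *)
Definition storage_function {R : realType} {W : normedModType R} (X : set W)
    (V : W -> R) : Prop :=
  forall x, X x -> 0 <= V x /\ differentiable V x.

Definition IF_OFP {R : realType} {n m : nat} (G : system R n m) (nu rho : R)
    : Prop :=
  exists2 V : 'cV[R]_n -> R, storage_function (state_space G) V &
    forall (a : R) (b : \bar R) (x : R -> 'cV[R]_n) (u y : R -> 'cV[R]_m),
      solution G (time_interval a%:E b) x u y ->
      forall t, time_interval a%:E b t ->
        exists2 Vdot : R, is_time_derivative (fun s => V (x s) : R^o) t Vdot &
          Vdot <= dot (u t) (y t) - rho * dot (y t) (y t)
                  - nu * dot (u t) (u t).

Record loop_values (R : realType) (np nc m : nat) := LoopValues {
  xp : 'cV[R]_np; up : 'cV[R]_m; yp : 'cV[R]_m;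
  xc : 'cV[R]_nc; uc : 'cV[R]_m; yc : 'cV[R]_m }.

Definition loop_solution {R : realType} {np nc m : nat} (Gp : system R np m)
    (Gc : system R nc m) (I : set R) (z : R -> loop_values R np nc m) : Prop :=
  solution Gp I (fun s => xp (z s)) (fun s => up (z s)) (fun s => yp (z s)) /\
  solution Gc I (fun s => xc (z s)) (fun s => uc (z s)) (fun s => yc (z s)).

(* The feedback equations while the controller is fed with the sample q. *)
Definition held_feedback {R : realType} {np nc m : nat}
    (w1 w2 : R -> 'cV[R]_m) (q : 'cV[R]_m) (I : set R)
    (z : R -> loop_values R np nc m) : Prop :=
  forall s, I s -> up (z s) = w1 s - yc (z s) /\ uc (z s) = w2 s + q.

Definition violates {R : realType} {np nc m : nat} (delta : R) (q : 'cV[R]_m)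
    (v : loop_values R np nc m) : Prop :=
  normsq (yp v - q) > delta * normsq (yp v).

(* A run z of the event-triggered loop on [t 0, T[.  The event instants are the
   finite values of t, so that t k = +oo encodes finitely many events; T may be
   finite in order to cover solutions with finite escape time; events do not
   accumulate before T.
   The last clause says that the event t k.+1 is triggered by the violation:
   t k.+1 is the first instant of violation (as an infimum, the condition being
   strict) when the sample taken at t k is kept past t k.+1.  This refers to a
   continuation z' of the held loop because the actual run is updated at
   t k.+1. *)
Definition event_triggered_run {R : realType} {np nc m : nat}
    (Gp : system R np m) (Gc : system R nc m) (delta : R)
    (w1 w2 : R -> 'cV[R]_m) (t : nat -> \bar R) (T : \bar R)
    (z : R -> loop_values R np nc m) : Prop :=
  let sample k := yp (z (fine (t k))) in
  let hold k := time_interval (t k) (Order.min (t k.+1) T) in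
  [/\ [/\ t 0%N \is a fin_num,
          forall k, (t k <= t k.+1)%E,
          forall k, (t k < T)%E -> (t k < t k.+1)%E &
          (T <= ereal_sup (range t))%E],
      loop_solution Gp Gc (time_interval (t 0%N) T) z,
      forall k, held_feedback w1 w2 (sample k) (hold k) z,
      forall k s, hold k s -> ~ violates delta (sample k) (z s) &
      forall k, (t k.+1 < T)%E ->
        exists (c : \bar R) (z' : R -> loop_values R np nc m),
          let J := time_interval (t k) c in
          [/\ (t k.+1 < c)%E,
              loop_solution Gp Gc J z',
              held_feedback w1 w2 (sample k) J z',
              forall s, time_interval (t k) (t k.+1) s -> z' s = z s &
              t k.+1 = ereal_inf
                [set s%:E | s in [set s | J s /\
                                   violates delta (sample k) (z' s)]]]].

(* One storage function serves all external signals and all runs. *)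
Definition event_triggered_passive {R : realType} {np nc m : nat}
    (Gp : system R np m) (Gc : system R nc m) (delta eps0 delta0 : R) : Prop :=
  exists2 V : 'cV[R]_np * 'cV[R]_nc -> R,
    storage_function (state_space Gp `*` state_space Gc) V &
    forall (w1 w2 : R -> 'cV[R]_m) (t : nat -> \bar R) (T : \bar R)
           (z : R -> loop_values R np nc m),
      event_triggered_run Gp Gc delta w1 w2 t T z ->
      forall (k : nat) (s : R),
        time_interval (t k) (Order.min (t k.+1) T) s ->
        let w := col_mx (w1 s) (w2 s) in
        let y := col_mx (yp (z s)) (yc (z s)) in
        exists2 Vdot : R,
          is_time_derivative (fun r => V (xp (z r), xc (z r)) : R^o) s Vdot &
          Vdot <= dot w y - eps0 * dot w w - delta0 * dot y y.

Definition beta {R : realType} (rho_p delta nu_c : R) : R :=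
  if 0 < nu_c then rho_p - nu_c - delta * (1 + nu_c)
  else if nu_c == 0 then rho_p - delta
  else rho_p + 2 * nu_c - delta * (1 - 3 * nu_c).

(* Main.v *)
Require Import Defs.
From mathcomp Require Import all_boot all_order all_algebra.
From mathcomp Require Import all_classical all_reals all_analysis.
From mathcomp Require Import ring lra.
Import Order.TTheory GRing.Theory Num.Theory.
Import numFieldNormedType.Exports.
Local Open Scope ring_scope.

(** The storage function of the loop is the sum [Vp + Vc] of the storage
    functions of the plant and of the controller.  Adding the two dissipation
    inequalities and substituting [up = w1 - yc], [uc = w2 + yp - e], where
    [e] is the sampling error, the cross terms [yp . yc] cancel and

      [up . yp + uc . yc = w . y - e . yc].

    The remaining indefinite terms are all absorbed by Young's inequality
    ([dot_young]), with [|e|^2 <= delta |yp|^2] at the end: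
    - [- e . yc <= |e|^2 + |yc|^2 / 4], the source of the [1/4] and of a
      [delta] in [beta];
    - the cross term [2 nu_p w1 . yc] of [- nu_p |w1 - yc|^2] is paid for by
      the surplus [(nu_p - eps0) |w1|^2], at the price
      [nu_p^2 / (nu_p - eps0)] on [|yc|^2];
    - if [nu_c >= 0], then [- nu_c |uc|^2] and [eps0 |w2|^2] are nonpositive
      and there is nothing to absorb; if [nu_c < 0], then
      [- nu_c |w2 + yp - e|^2] is nonnegative, and each of its three cross
      terms is split with its own weight ([held_input_bound]).

    The triggering rule enters only through the error bound, and time only
    through the linearity of the derivative, so that the heart of the proof is
    the pointwise inequality [loop_supply_bound] between vectors. *)

(** * The Euclidean inner product *)

Section InnerProduct.
Context {R : realType} {m : nat}.
Implicit Types (u v w : 'cV[R]_m) (a c : R).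

Lemma dotE u v : dot u v = \sum_i u i 0 * v i 0.
Proof. by rewrite /dot mxE; apply: eq_bigr => i _; rewrite mxE. Qed.

Lemma dotC u v : dot u v = dot v u.
Proof. by rewrite !dotE; apply: eq_bigr => i _; rewrite mulrC. Qed.

Lemma dotDl u v w : dot (u + v) w = dot u w + dot v w.
Proof. by rewrite /dot linearD /= mulmxDl mxE. Qed.

Lemma dotNl u v : dot (- u) v = - dot u v.
Proof. by rewrite /dot linearN /= mulNmx mxE. Qed.

Lemma dotZl a u v : dot (a *: u) v = a * dot u v.
Proof. by rewrite /dot linearZ /= -scalemxAl mxE. Qed.

Lemma dotDr u v w : dot u (v + w) = dot u v + dot u w.
Proof. by rewrite /dot mulmxDr mxE. Qed.

Lemma dotNr u v : dot u (- v) = - dot u v.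
Proof. by rewrite /dot mulmxN mxE. Qed.

Lemma dotZr a u v : dot u (a *: v) = a * dot u v.
Proof. by rewrite /dot -scalemxAr mxE. Qed.

Definition dot_linear := (dotDl, dotDr, dotNl, dotNr, dotZl, dotZr).

Lemma dot_ge0 u : 0 <= dot u u.
Proof. by rewrite dotE; apply: sumr_ge0 => i _; rewrite -expr2 sqr_ge0. Qed.

Lemma dot_young a {c} u v : 0 < c ->
  2 * a * dot u v <= c * dot u u + a ^+ 2 / c * dot v v.
Proof.
move=> c_gt0; rewrite -subr_ge0.
have -> : c * dot u u + a ^+ 2 / c * dot v v - 2 * a * dot u v
          = dot (c *: u - a *: v) (c *: u - a *: v) / c.
  by rewrite !dot_linear (dotC v u); field; rewrite gt_eqF.
by rewrite divr_ge0 ?dot_ge0 ?ltW.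
Qed.

End InnerProduct.

Lemma dot_col_mx {R : realType} {m1 m2 : nat}
    (a b : 'cV[R]_m1) (c d : 'cV[R]_m2) :
  dot (col_mx a c) (col_mx b d) = dot a b + dot c d.
Proof. by rewrite /dot tr_col_mx mul_row_col mxE. Qed.

(** * The supply rate of the loop *)

Section SupplyRate.
Context {R : realType} {m : nat}.

(** Of the output loss [rho_p - beta] of the plant, one [delta] is reserved for
    the term [e . yc]; the rest pays for the controller input.
    If [nu_c >= 0], the left-hand side is nonpositive and the right-hand side
    is nonnegative.
    If [nu_c < 0], put [a = - nu_c] and expand [a |w2 + yp - e|^2].  The three
    cross terms are bounded by
    - [- 2 a yp . e <= a |yp|^2 + a |e|^2],
    - [- 2 a w2 . e <= a |w2|^2 + a |e|^2],
    - [2 a w2 . yp <= g |w2|^2 + a^2 / g |yp|^2] with [g = - 2 a - eps0].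
    Together with the squares this makes [2 a |yp|^2 + 3 a |e|^2], which is
    the case [nu_c < 0] of [beta], and [(2 a + g) |w2|^2 = - eps0 |w2|^2]; the
    weight [g] is positive exactly when [eps0 < nu_c - |nu_c|]. *)
Lemma held_input_bound rho_p {nu_c delta eps0 : R} w2 {yp e : 'cV[R]_m} :
    0 <= delta -> eps0 < nu_c - `|nu_c| -> dot e e <= delta * dot yp yp ->
  - nu_c * dot (w2 + yp - e) (w2 + yp - e) + eps0 * dot w2 w2
  <= (rho_p - delta - beta rho_p delta nu_c
      + nu_c ^+ 2 / (nu_c - `|nu_c| - eps0)) * dot yp yp.
Proof.
move=> delta_ge0 heps he.
have w2_ge0 := dot_ge0 w2; have yp_ge0 := dot_ge0 yp.
have gap_gt0 : 0 < nu_c - `|nu_c| - eps0 by rewrite subr_gt0.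
have price_ge0 : 0 <= nu_c ^+ 2 / (nu_c - `|nu_c| - eps0).
  by rewrite divr_ge0 ?sqr_ge0 ?ltW.
have [nu_lt0|nu_ge0] := ltP nu_c 0; last first.
  have eps_lt0 : eps0 < 0 by move: heps; rewrite ger0_norm // subrr.
  apply: (@le_trans _ _ 0).
    rewrite -[leRHS]addr0; apply: lerD; last by rewrite nmulr_rle0.
    by rewrite mulNr oppr_le0 mulr_ge0 ?dot_ge0.
  apply: mulr_ge0 => //; apply: addr_ge0 => //.
  have := mulr_ge0 delta_ge0 nu_ge0; rewrite /beta.
  case: (ltgtP nu_c 0) nu_ge0 => //= [nu_gt0|->] _; lra.
have nu_abs : nu_c - `|nu_c| = 2 * nu_c by rewrite ltr0_norm //; ring.
rewrite nu_abs in gap_gt0 price_ge0 *.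
have -> : beta rho_p delta nu_c = rho_p + 2 * nu_c - delta * (1 - 3 * nu_c).
  by rewrite /beta ltNge (ltW nu_lt0) /= lt_eqF.
have minus_nu_gt0 : 0 < - nu_c by rewrite oppr_gt0.
have w2_yp := dot_young (- nu_c) w2 yp gap_gt0.
have w2_e := dot_young nu_c w2 e minus_nu_gt0.
have yp_e := dot_young (-1) yp e ltr01.
have self_price : nu_c ^+ 2 / - nu_c = - nu_c by field; rewrite lt_eqF.
rewrite self_price in w2_e.
rewrite sqrrN in w2_yp.
rewrite !expr2 !mulrNN !mul1r ?invr1 ?mul1r in yp_e.
have yp_e' := ler_wpM2l (ltW minus_nu_gt0) yp_e.
have he' := ler_wpM2l (ltW minus_nu_gt0) he.
rewrite !dot_linear (dotC yp w2) (dotC e w2) (dotC e yp).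
lra.
Qed.

(** The sum of the supply rates of the plant and of the controller, seen as a
    quadratic form.  The vectors are subject to the feedback equations, with
    [yp - e] as the held sample, and time has disappeared; once the cross terms
    are bounded, what remains is linear in the inner products. *)
Lemma loop_supply_bound {nu_p rho_p nu_c rho_c delta eps0 delta0 : R}
    {w1 w2 yp yc e : 'cV[R]_m} :
    0 <= delta ->
    eps0 < Num.min nu_p (nu_c - `|nu_c|) ->
    delta0 < Num.min (beta rho_p delta nu_c
                      - nu_c ^+ 2 / (nu_c - `|nu_c| - eps0))
                     (rho_c + nu_p - 1 / 4 - nu_p ^+ 2 / (nu_p - eps0)) ->
    dot e e <= delta * dot yp yp ->
  let up := w1 - yc in
  let uc := w2 + yp - e in
  let w := col_mx w1 w2 in
  let y := col_mx yp yc in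
  (dot up yp - rho_p * dot yp yp - nu_p * dot up up)
  + (dot uc yc - rho_c * dot yc yc - nu_c * dot uc uc)
  <= dot w y - eps0 * dot w w - delta0 * dot y y.
Proof.
move=> delta_ge0; rewrite !lt_min => /andP[heps_p heps_c] /andP[hyp hyc] he.
rewrite /= !dot_col_mx.
have uc_bound := held_input_bound rho_p w2 delta_ge0 heps_c he.
have gap_gt0 : 0 < nu_p - eps0 by rewrite subr_gt0.
have w1_yc := dot_young nu_p w1 yc gap_gt0.
have e_yc := dot_young (- (1 / 2)) e yc ltr01.
have quarter : (- (1 / 2)) ^+ 2 / 1 = 1 / 4 :> R by field.
rewrite quarter in e_yc.
have yp_surplus := ler_wpM2r (dot_ge0 yp) (ltW hyp).
have yc_surplus := ler_wpM2r (dot_ge0 yc) (ltW hyc).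
set uc2 := dot (w2 + yp - e) (w2 + yp - e) in uc_bound *.
rewrite !dot_linear (dotC yc w1) (dotC yc yp).
lra.
Qed.

End SupplyRate.

(** * Sums of storage functions *)

Lemma is_time_derivativeD {R : realType} {W : normedModType R} (f g : R -> W)
    (t : R) (df dg : W) :
  is_time_derivative f t df -> is_time_derivative g t dg ->
  is_time_derivative (fun s => f s + g s) t (df + dg).
Proof.
move=> hf hg; rewrite /is_time_derivative.
have -> : (fun s => (s - t)^-1 *: (f s + g s - (f t + g t)))
    = (fun s => (s - t)^-1 *: (f s - f t) + (s - t)^-1 *: (g s - g t)).
  by apply/funext => s; rewrite -scalerDr opprD addrACA.
exact: cvgD hf hg.
Qed.

Lemma storage_function_sum {R : realType} {W1 W2 : normedModType R}
    (X1 : set W1) (X2 : set W2) (V1 : W1 -> R) (V2 : W2 -> R) :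
  storage_function X1 V1 -> storage_function X2 V2 ->
  storage_function (X1 `*` X2)%classic (fun p => V1 p.1 + V2 p.2).
Proof.
move=> h1 h2 [x1 x2] [/= /h1[V1_ge0 dV1] /h2[V2_ge0 dV2]].
split; first exact: addr_ge0.
apply: (@differentiableD _ _ _ (V1 \o fst) (V2 \o snd)).
  apply: (@differentiable_comp _ _ _ _ fst V1) => //.
  by apply: linear_differentiable => p; exact: cvg_fst.
apply: (@differentiable_comp _ _ _ _ snd V2) => //.
by apply: linear_differentiable => p; exact: cvg_snd.
Qed.

(** * Passivity of the event-triggered loop *)

Theorem theorem3 (R : realType) (np nc m : nat)
    (Gp : system R np m) (Gc : system R nc m)
    (nu_p rho_p nu_c rho_c delta eps0 delta0 : R)
    (hGp : IF_OFP Gp nu_p rho_p)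
    (hGc : IF_OFP Gc nu_c rho_c)
    (hdelta : 0 < delta <= 1)
    (heps0 : eps0 < Num.min nu_p (nu_c - `|nu_c|))
    (hdelta0 : delta0 <
       Num.min (beta rho_p delta nu_c
                - nu_c ^+ 2 / (nu_c - `|nu_c| - eps0))
               (rho_c + nu_p - 1 / 4 - nu_p ^+ 2 / (nu_p - eps0))) :
  event_triggered_passive Gp Gc delta eps0 delta0.
Proof.
case: hGp => Vp stVp dissp; case: hGc => Vc stVc dissc.
have [/ltW delta_ge0 _] := andP hdelta.
exists (fun x => Vp x.1 + Vc x.2); first exact: storage_function_sum.
move=> w1 w2 t T z [[t0_fin t_mono _ _] [solp solc] held no_viol _] k s hold_s.
(* The plant and the controller are dissipative along the whole run, so the
   hold interval only has to be located inside of it. *)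
have t0_le : (t 0%N <= t k)%E by elim: k {hold_s} => // k /le_trans; apply.
have s_run : time_interval (fine (t 0%N))%:E T s.
  case: hold_s => tk_le; rewrite lt_min => /andP[_ s_lt].
  by split=> //; rewrite fineK // (le_trans t0_le).
rewrite -(fineK t0_fin) in solp solc.
have [dVp derp lep] := dissp _ _ _ _ _ solp _ s_run.
have [dVc derc lec] := dissc _ _ _ _ _ solc _ s_run.
exists (dVp + dVc); first exact: is_time_derivativeD derp derc.
have [up_eq uc_eq] := held _ _ hold_s.
set q := yp (z (fine (t k))) in uc_eq.
have error_bound : dot (yp (z s) - q) (yp (z s) - q)
                   <= delta * dot (yp (z s)) (yp (z s)).
  by rewrite leNgt; apply/negP; exact: no_viol hold_s.
have q_eq : w2 s + q = w2 s + yp (z s) - (yp (z s) - q).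
  by rewrite opprB -addrA [yp _ + _]addrC subrK.
apply: le_trans (lerD lep lec) _.
rewrite up_eq uc_eq q_eq.
exact: loop_supply_bound delta_ge0 heps0 hdelta0 error_bound.
Qed.
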